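(* Let $M=(V,D)$ be a vf-closed $\Delta$-matroid and $n=|V|$. Then $q_1(M)(-2)=(-1)^n(-2)^{d_{M\,\bar{*}\,V}}$.
   Context: A set system is $M=(V,D)$ with $V$ finite, $D$ a family of subsets of $V$; write $Z\in M$ for $Z\in D$; proper means $D\neq\emptyset$. $\oplus$ is symmetric difference. Pivot: $M*X=(V,\{Z\oplus X:Z\in D\})$; loop complementation: $M+w=(V,D\oplus\{Z\cup\{w\}:Z\in D,w\notin Z\})$; operations are applied left to right; dual pivot $M\,\bar{*}\,w=M+w*w+w$; operations on distinct elements commute, and $M\,\bar{*}\,V$ denotes applying $\bar{*}\,w$ for all $w\in V$. For proper $M$, $d_M(X)=\min\{|X\oplus Z|:Z\in M\}$, $d_M=d_M(\emptyset)$, and $q_1(M)(y)=\sum_{X\subseteq V}y^{d_{M*X}}$. A $\Delta$-matroid is a proper set system such that for all $X,Y\in M$ and $w\in X\oplus Y$, either $X\oplus\{w\}\in M$ or some $v\in X\oplus Y$, $v\neq w$, has $X\oplus\{w,v\}\in M$. $M$ is a vf-closed $\Delta$-matroid if $M\varphi$ is a $\Delta$-matroid for every sequence $\varphi$ of pivots and loop complementations on elements of $V$. *)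

(* Defs.v *)
From HB Require Import structures.
From mathcomp Require Import all_boot all_order all_algebra.

Set Implicit Arguments.
Unset Strict Implicit.
Unset Printing Implicit Defensive.

Import GRing.Theory.

(* A set system (V, D) is given by the family D : {set {set T}} over a finite
   type T whose elements form the ground set V (so V = [set: T], |V| = #|T|). *)
Notation set_system T := {set {set T}}.

Section SetSystems.

Variable T : finType.
Implicit Types (M : set_system T) (X Y Z : {set T}) (w v : T).

Definition proper_sys M : Prop := M != set0.

(* The ground type is generic: this is also used on families of subsets. *)
Definition symdiff (U : finType) (A B : {set U}) : {set U} :=
  (A :\: B) :|: (B :\: A).

Definition pivot M X : set_system T := [set symdiff Z X | Z in M].

Definition loopc M w : set_system T :=
  symdiff M [set w |: Z | Z in M & w \notin Z].

(* M + w * w + w, operations being applied from left to right. *)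
Definition dual_pivot M w : set_system T :=
  loopc (pivot (loopc M w) [set w]) w.

(* The order of the elements is the one of [enum X]; it is irrelevant since
   dual pivots on distinct elements commute. *)
Definition dual_pivots M X : set_system T := foldl dual_pivot M (enum X).

(* Distances never exceed #|T|, so for proper M the default value #|T| does
   not affect the minimum. *)
Definition dist M X : nat := \big[minn/#|T|]_(Z in M) #|symdiff X Z|.

Definition dist0 M : nat := dist M set0.

Definition q1 M : {poly int} :=
  (\sum_(X : {set T}) 'X^(dist0 (pivot M X)))%R.

Definition delta_matroid M : Prop :=
  proper_sys M /\
  (forall X Y w, X \in M -> Y \in M -> w \in symdiff X Y ->
     symdiff X [set w] \in M \/
     exists v, [/\ v \in symdiff X Y, v != w & symdiff X [set w; v] \in M]).

Inductive vf_op : Type := Pivot of T | LoopCompl of T.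

Definition apply_op M (o : vf_op) : set_system T :=
  match o with
  | Pivot w => pivot M [set w]
  | LoopCompl w => loopc M w
  end.

Definition vf_closed_delta_matroid M : Prop :=
  forall phi : seq vf_op, delta_matroid (foldl apply_op M phi).

End SetSystems.

(* Main.v *)
(** Write M = (A, B) with A the members of M avoiding w and B the members
    containing w, the latter with w deleted; then M * w = (B, A) and the dual
    pivot of M at w is (A + B, B) with + symmetric difference.  If A and B both
    contain sets of the least size m occurring in either, the exchange axiom for
    M and M * w forces A and B to have the same sets of size m, so A + B has
    none.  Hence among d(M), d(M * w) and the distance of the dual pivot two
    equal m and the third is m + 1, and in all three cases, with y = -2,
    y^d(M) + y^d(M * w) is the opposite of the corresponding power for the dual
    pivot.  Summing this identity over one element of V after another gives the
    theorem. *)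
Require Import Defs.
From mathcomp Require Import all_boot all_order all_algebra.
From mathcomp Require Import ring.

Set Implicit Arguments.
Unset Strict Implicit.
Unset Printing Implicit Defensive.

Import GRing.Theory.

Section SetSystemTheory.

Variable T : finType.
Implicit Types (M : {set {set T}}) (X Y Z : {set T}) (v w x : T) (s : seq T).

(** * Membership rules and commutation for pivots and dual pivots *)

Lemma in_symdiff (U : finType) (A B : {set U}) (u : U) :
  (u \in symdiff A B) = (u \in A) (+) (u \in B).
Proof. by rewrite !inE; case: (u \in A); case: (u \in B). Qed.

Lemma symdiffA (U : finType) : associative (@symdiff U).
Proof. by move=> A B C; apply/setP=> u; rewrite !in_symdiff addbA. Qed.

Lemma symdiffK (U : finType) (A B : {set U}) : symdiff (symdiff A B) B = A.
Proof. by apply/setP=> u; rewrite !in_symdiff addbK. Qed.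

Lemma symdiff1_in Z w : w \in Z -> symdiff Z [set w] = Z :\ w.
Proof.
move=> wZ; apply/setP=> u; rewrite in_symdiff !inE.
by case: eqVneq => [->|]; rewrite ?wZ ?addbF.
Qed.

Lemma symdiff1_notin Z w : w \notin Z -> symdiff Z [set w] = w |: Z.
Proof.
move=> wZ; apply/setP=> u; rewrite in_symdiff !inE.
by case: eqVneq => [->|]; rewrite ?(negPf wZ) ?addbF.
Qed.

Lemma in_pivot M X Z : (Z \in pivot M X) = (symdiff Z X \in M).
Proof.
apply/imsetP/idP=> [[Y YM ->]|ZM]; first by rewrite symdiffK.
by exists (symdiff Z X); rewrite ?symdiffK.
Qed.

Lemma in_loopc M w Z :
  (Z \in loopc M w) = (Z \in M) (+) ((w \in Z) && (Z :\ w \in M)).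
Proof.
rewrite in_symdiff; congr (_ (+) _).
apply/imsetP/andP=> [[Y]|[wZ ZM]].
  by rewrite inE => /andP[YM wY] ->; rewrite setU11 setU1K.
by exists (Z :\ w); rewrite ?setD1K // !inE ZM eqxx.
Qed.

Lemma in_dual_pivot M w Z :
  (Z \in dual_pivot M w) =
  (Z \in M) (+) ((w \notin Z) && (w |: Z \in M)).
Proof.
rewrite /dual_pivot in_loopc !in_pivot !in_loopc.
have [wZ|wZ] := boolP (w \in Z) => /=.
  rewrite symdiff1_in // setD11 /= symdiff1_notin ?setD11 // setD1K // wZ.
  by case: (Z \in M); case: (Z :\ w \in M).
by rewrite symdiff1_notin // setU11 setU1K //= addbF addbC.
Qed.

Lemma pivotU1 M w X : w \notin X -> pivot M (w |: X) = pivot (pivot M [set w]) X.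
Proof.
move=> wX; apply/setP=> Z.
by rewrite !in_pivot -symdiffA symdiff1_notin.
Qed.

Lemma dual_pivot_pivotC M v w :
  v != w -> dual_pivot (pivot M [set v]) w = pivot (dual_pivot M w) [set v].
Proof.
move=> vw; apply/setP=> Z.
rewrite in_pivot !in_dual_pivot !in_pivot in_symdiff inE eq_sym (negPf vw) addbF.
congr (_ (+) (_ && (_ \in M))); apply/setP=> u; rewrite !inE.
by case: (eqVneq u w) => [->|] //=; rewrite eq_sym (negPf vw).
Qed.

Lemma foldl_dual_pivot_pivotC M v s :
  v \notin s ->
  foldl (@dual_pivot T) (pivot M [set v]) s
    = pivot (foldl (@dual_pivot T) M s) [set v].
Proof.
elim: s M => //= w s IHs M; rewrite inE negb_or => /andP[vw vs].
by rewrite dual_pivot_pivotC // IHs.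
Qed.

Lemma vf_closed_foldl M phi :
  vf_closed_delta_matroid M -> vf_closed_delta_matroid (foldl (@apply_op T) M phi).
Proof. by move=> hM psi; rewrite -foldl_cat. Qed.

Lemma vf_closed_pivot1 M w :
  vf_closed_delta_matroid M -> vf_closed_delta_matroid (pivot M [set w]).
Proof. exact: (@vf_closed_foldl M [:: Pivot w]). Qed.

Lemma vf_closed_dual_pivot M w :
  vf_closed_delta_matroid M -> vf_closed_delta_matroid (dual_pivot M w).
Proof. exact: (@vf_closed_foldl M [:: LoopCompl w; Pivot w; LoopCompl w]). Qed.

Lemma vf_closed_dual_pivots M s :
  vf_closed_delta_matroid M ->
  vf_closed_delta_matroid (foldl (@dual_pivot T) M s).
Proof. by elim: s M => //= w s IHs M /(@vf_closed_dual_pivot _ w)/IHs. Qed.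

(** * Distances and sets of least size *)

Lemma dist0_eq M Z k :
  Z \in M -> #|Z| = k -> (forall Y, Y \in M -> k <= #|Y|) -> dist0 M = k.
Proof.
move=> ZM Zk minM; rewrite /dist0 /dist.
have sd0 Y : #|symdiff set0 Y| = #|Y| by rewrite /symdiff set0D set0U setD0.
apply/eqP; rewrite eqn_leq; apply/andP; split.
  rewrite -Zk -(sd0 Z); have := mem_index_enum Z.
  elim: (index_enum _) => //= Y r IHr; rewrite inE big_cons.
  case/predU1P=> [<-|/IHr le]; first by rewrite ZM geq_minl.
  by case: ifP => // _; rewrite geq_min le orbT.
elim/big_ind: _ => [|a b ka kb|Y YM]; last by rewrite sd0 minM.
  (* The default value [#|T|] respects the bound, as [k] is the size of [Z]. *)
  by rewrite -Zk max_card.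
by rewrite leq_min ka.
Qed.

Lemma dist0_split_eq M w k Z :
  Z \in M -> #|Z| = k ->
  (forall Y, w \notin Y -> Y \in M -> k <= #|Y|) ->
  (forall Y, w \notin Y -> w |: Y \in M -> k <= #|Y|.+1) -> dist0 M = k.
Proof.
move=> ZM Zk min0 min1; apply: (dist0_eq ZM Zk) => Y YM.
have [wY|wY] := boolP (w \in Y); last exact: min0.
by rewrite (cardsD1 w) wY min1 ?setD11 ?setD1K.
Qed.

(** Induction on [#|X :\: Y|], moving [X] towards [Y] inside [M]. Exchange [X] with [w |: Y] at some
    [x] in [X :\: Y]. Removing [x] alone, or [x] with another element of [X], or trading [x] for
    [w], gives a member with fewer than [m] elements besides [w]. So [x] is traded for some [v] in
    [Y :\: X]. *)
Lemma delta_matroid_min_exchange M w m X Y :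
  delta_matroid M -> (forall Z, Z \in M -> m <= #|Z :\ w|) ->
  X \in M -> w \notin X -> #|X| = m ->
  w |: Y \in M -> w \notin Y -> #|Y| = m -> Y \in M.
Proof.
move=> [_ exch] minM XM wX Xm wYM wY Ym.
have [k] := ubnP #|X :\: Y|; elim: k X XM wX Xm => // k IHk X XM wX Xm ltk.
(* If [X] lies inside [Y], the equal sizes force [X = Y]. *)
have [XY0|[x]] := set_0Vmem (X :\: Y).
  suff -> : Y = X by [].
  apply/esym/eqP; rewrite eqEcard Xm Ym leqnn andbT.
  by rewrite -setD_eq0 XY0.
rewrite inE => /andP[xY xX].
have xw : x != w by apply: contraNneq wX => <-.
have cardX : #|X| = #|X :\ x|.+1 by rewrite (cardsD1 x) xX.
have [||] := exch X (w |: Y) x XM wYM.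
- by rewrite in_symdiff xX in_setU1 (negPf xw) (negPf xY).
- rewrite symdiff1_in // => /minM; rewrite -Xm cardX.
  by move/leq_trans/(_ (subset_leq_card (subsetDl _ _))); rewrite ltnn.
case=> v [vXY vx ZM].
have [vX|vX] := boolP (v \in X).
  have sub : symdiff X [set x; v] :\ w \subset X :\ x.
    apply/subsetP=> u; rewrite in_setD1 in_symdiff in_setD1 in_set2.
    case: (eqVneq u x) => [->|] /=; first by rewrite xX andbF.
    by case: (eqVneq u v) => [->|]; rewrite ?vX ?andbF //= addbF => _ _ /andP[].
  have := leq_trans (minM _ ZM) (subset_leq_card sub).
  by rewrite -Xm cardX ltnn.
have EZ : symdiff X [set x; v] = v |: X :\ x.
  apply/setP=> u; rewrite in_symdiff !inE.
  case: (eqVneq u x) => [->|]; first by rewrite xX eq_sym (negPf vx).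
  by case: (eqVneq u v) => [->|] /=; rewrite ?(negPf vX) // addbF.
rewrite EZ in ZM.
have vXx : v \notin X :\ x by rewrite !inE (negPf vX) andbF.
have [vw|vw] := eqVneq v w.
  by have := minM _ ZM; rewrite vw setU1K -?vw // -Xm cardX ltnn.
have vY : v \in Y.
  by move: vXY; rewrite in_symdiff (negPf vX) !inE (negPf vw).
apply: (IHk _ ZM).
- by rewrite !inE eq_sym (negPf vw) (negPf wX) andbF.
- by rewrite cardsU1 vXx -Xm cardX.
apply: (@leq_trans #|X :\: Y|) => //.
apply: proper_card; apply/properP; split.
  apply/subsetP=> u; rewrite !inE => /andP[uY].
  case: (eqVneq u v) => [uv|_ /=]; first by rewrite uv vY in uY.
  by case/andP=> _ ->; rewrite uY.
by exists x; rewrite !inE ?xX ?xY // eqxx /= eq_sym (negPf vx).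
Qed.

(** Each direction is the previous lemma: for [M] starting from [X], and for the pivot at [w], where
    the two halves trade places, starting from [Y]. The bound carries over because pivoting at [w]
    does not change [Z :\ w]. *)
Lemma vf_closed_min_iff M w m X Y Z :
  vf_closed_delta_matroid M -> (forall Z, Z \in M -> m <= #|Z :\ w|) ->
  X \in M -> w \notin X -> #|X| = m ->
  w |: Y \in M -> w \notin Y -> #|Y| = m ->
  w \notin Z -> #|Z| = m -> (Z \in M) = (w |: Z \in M).
Proof.
move=> hM minM XM wX Xm YM wY Ym wZ Zm.
have sD U : symdiff U [set w] :\ w = U :\ w.
  apply/setP=> u; rewrite !in_setD1 in_symdiff in_set1.
  by case: (u == w); rewrite ?addbF.
have wU U : symdiff (w |: U) [set w] = U :\ w.
  by rewrite symdiff1_in ?setU11 // setDUl setDv set0U.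
apply/idP/idP=> [ZM|ZM].
  have -> : w |: Z = symdiff Z [set w] by rewrite symdiff1_notin.
  rewrite -in_pivot.
  apply: (@delta_matroid_min_exchange _ w m Y) => //.
  - exact: (vf_closed_pivot1 w hM [::]).
  - by move=> U; rewrite in_pivot -(sD U); apply: minM.
  - by rewrite in_pivot symdiff1_notin.
  - by rewrite in_pivot symdiff1_in ?setU11 // setU1K.
exact: (@delta_matroid_min_exchange M w m X Z (hM [::])).
Qed.

Lemma dist0_three_term M w :
  vf_closed_delta_matroid M ->
  ((-2%:R) ^+ dist0 M + (-2%:R) ^+ dist0 (pivot M [set w])
     = - (-2%:R) ^+ dist0 (dual_pivot M w) :> int)%R.
Proof.
move=> hM.
have [/set0Pn[Z0 /= Z0M] _] := hM [::].
have [Z1 /= Z1M minM] := @arg_minnP _ Z0 [in M] (fun Z => #|Z :\ w|) Z0M.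
move Em : #|Z1 :\ w| minM => m minM.
have minM0 Z : w \notin Z -> Z \in M -> m <= #|Z|.
  by move=> wZ ZM; have := minM _ ZM; rewrite (cardsD1 w Z) (negPf wZ).
have minM1 Z : w \notin Z -> w |: Z \in M -> m <= #|Z|.
  by move=> wZ /minM; rewrite setU1K.
have P0 Y : w \notin Y -> (Y \in pivot M [set w]) = (w |: Y \in M).
  by move=> wY; rewrite in_pivot symdiff1_notin.
have P1 Y : w \notin Y -> (w |: Y \in pivot M [set w]) = (Y \in M).
  by move=> wY; rewrite in_pivot symdiff1_in ?setU11 // setU1K.
have D0 Y : w \notin Y ->
    (Y \in dual_pivot M w) = (Y \in M) (+) (w |: Y \in M).
  by move=> wY; rewrite in_dual_pivot wY.
have D1 Y : (w |: Y \in dual_pivot M w) = (w |: Y \in M).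
  by rewrite in_dual_pivot setU11 addbF.
have cU Y : w \notin Y -> #|w |: Y| = #|Y|.+1 by move=> wY; rewrite cardsU1 wY.
have minD Y : w \notin Y -> Y \in dual_pivot M w -> m <= #|Y|.
  move=> wY; rewrite D0 //; have := minM0 Y wY; have := minM1 Y wY.
  by case: (Y \in M) => [_ ->|] //=; move=> ->.
(* Whether the least size [m] is attained by members avoiding [w], and by members containing [w]
   once [w] is deleted. *)
pose inA := [exists X : {set T}, [&& w \notin X, #|X| == m & X \in M]].
pose inB := [exists X : {set T}, [&& w \notin X, #|X| == m & w |: X \in M]].
have [/existsP[X /and3P[wX /eqP Xm XM]]|/existsPn noA] := boolP inA;
  have [/existsP[Y /and3P[wY /eqP Ym YM]]|/existsPn noB] := boolP inB.
- have E0 : dist0 M = m.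
    by apply: (@dist0_split_eq _ w _ X) => // Z wZ ZM; apply/leqW/minM1.
  have E1 : dist0 (pivot M [set w]) = m.
    apply: (@dist0_split_eq _ w _ Y); rewrite ?P0 // => Z wZ;
      rewrite ?P1 // ?P0 //.
      exact: minM1.
    by move=> ZM; apply/leqW/minM0.
  have E2 : dist0 (dual_pivot M w) = m.+1.
    (* Sets of size [m] cancel in the dual pivot, while [w |: Y] remains and has size [m.+1]. *)
    apply: (@dist0_split_eq _ w _ (w |: Y)); rewrite ?D1 ?cU ?Ym // => Z wZ ZN.
      rewrite ltn_neqAle minD // andbT; apply: contraTneq ZN => mZ.
      by rewrite D0 // (@vf_closed_min_iff M w m X Y Z) // addbb.
    by rewrite D1 in ZN; rewrite ltnS minM1.
  (* The value y = -2 satisfies 2 = -y, used here, and 1 + y = -1, used in the other two cases. *)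
  by rewrite E0 E1 E2 exprS; ring.
- have ltB Z : w \notin Z -> w |: Z \in M -> m < #|Z|.
    move=> wZ ZM; rewrite ltn_neqAle minM1 // andbT.
    by have := noB Z; rewrite wZ ZM andbT eq_sym.
  have E0 : dist0 M = m.
    by apply: (@dist0_split_eq _ w _ X) => // Z wZ ZM; apply/leqW/minM1.
  have E1 : dist0 (pivot M [set w]) = m.+1.
    apply: (@dist0_split_eq _ w _ (w |: X)); rewrite ?P1 ?cU ?Xm // => Z wZ;
      rewrite ?P1 // ?P0 //.
      exact: ltB.
    exact: minM0.
  (* Since [w |: X] is not in [M], nothing cancels [X]. *)
  have E2 : dist0 (dual_pivot M w) = m.
    apply: (@dist0_split_eq _ w _ X); rewrite ?D0 ?XM //.
    - by apply: contraTN isT => /ltB; rewrite Xm ltnn; apply.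
    - by move=> Z wZ; rewrite D1 => ZM; apply/leqW/minM1.
  by rewrite E0 E1 E2 exprS; ring.
- have ltA Z : w \notin Z -> Z \in M -> m < #|Z|.
    move=> wZ ZM; rewrite ltn_neqAle minM0 // andbT.
    by have := noA Z; rewrite wZ ZM andbT eq_sym.
  have E0 : dist0 M = m.+1.
    by apply: (@dist0_split_eq _ w _ (w |: Y)); rewrite ?cU ?Ym // => Z wZ ZM;
      apply: minM1.
  have E1 : dist0 (pivot M [set w]) = m.
    apply: (@dist0_split_eq _ w _ Y); rewrite ?P0 // => Z wZ;
      rewrite ?P1 // ?P0 //.
      exact: minM1.
    by move=> ZM; apply/leqW/minM0.
  have E2 : dist0 (dual_pivot M w) = m.
    apply: (@dist0_split_eq _ w _ Y); rewrite ?D0 ?YM ?addbT //.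
    - by apply: contraTN isT => /ltA; rewrite Ym ltnn; apply.
    - by move=> Z wZ; rewrite D1 => ZM; apply/leqW/minM1.
  by rewrite E0 E1 E2 exprS; ring.
(* One of the two must hold, since [Z1] attains the minimum [m]. *)
have [wZ1|wZ1] := boolP (w \in Z1).
  by have := noB (Z1 :\ w); rewrite setD11 Em eqxx setD1K // Z1M.
have := noA Z1; rewrite wZ1 Z1M andbT /= -Em.
by rewrite (cardsD1 w Z1) (negPf wZ1) eqxx.
Qed.

(** Induction on [s] from its last element [w], for all [M] at once: the subsets avoiding [w] give
    the sum for [M], those containing [w] the sum for its pivot at [w]. *)
Lemma sum_dist0_pivot M s :
  uniq s -> vf_closed_delta_matroid M ->
  (\sum_(X : {set T} | X \subset s) (-2%:R) ^+ dist0 (pivot M X)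
     = (-1) ^+ size s * (-2%:R) ^+ dist0 (foldl (@dual_pivot T) M s) :> int)%R.
Proof.
elim/last_ind: s M => [|s w IHs] M.
  move=> _ _; rewrite (big_pred1 set0) => [|X]; last first.
    by rewrite /= -subset0; apply: eq_subset_r => x; rewrite inE.
  rewrite mul1r; congr (_ ^+ dist0 _)%R; apply/setP=> Z.
  by rewrite in_pivot /symdiff setD0 set0D setU0.
rewrite rcons_uniq => /andP[ws us] hM.
rewrite (bigID (fun X : {set T} => w \in X)) /=.
have sub_notin X : (X \subset rcons s w) && (w \notin X) = (X \subset s).
  apply/andP/idP=> [[/subsetP Xs wX]|/subsetP Xs].
    apply/subsetP=> x xX; have := Xs _ xX.
    by rewrite mem_rcons inE; case: eqP xX wX => // -> ->.
  split; last by apply: contra ws => /Xs.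
  by apply/subsetP=> x /Xs; rewrite mem_rcons inE => ->; rewrite orbT.
rewrite addrC (eq_bigl _ _ sub_notin) IHs //.
rewrite (reindex_onto (fun X => w |: X) (fun X => X :\ w)) /=; last first.
  by move=> X /andP[_ wX]; rewrite setD1K.
(* The reindexing condition [(w |: X) :\ w == X] says that [w] is not in [X]. *)
rewrite (eq_bigl (fun X : {set T} => X \subset s)) => [|X]; last first.
  rewrite setU11 andbT -sub_notin.
  have [wX|wX] := boolP (w \in X).
    rewrite andbF; apply/negbTE/negP=> /andP[_ /eqP E].
    by move: wX; rewrite -E setD11.
  rewrite setU1K // eqxx !andbT; apply/subsetP/subsetP=> Xs x.
    by move=> xX; apply: Xs; rewrite setU1r.
  by case/setU1P=> [->|/Xs //]; rewrite mem_rcons inE eqxx.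
rewrite (eq_bigr (fun X =>
  (-2%:R) ^+ dist0 (pivot (pivot M [set w]) X))%R); last first.
  by move=> X /subsetP Xs; rewrite pivotU1 //; apply: contra ws => /Xs.
rewrite IHs //; last exact: vf_closed_pivot1.
(* Moving the pivot at [w] past the dual pivots along [s] makes both terms concern one system and
   its pivot, as the three-term identity requires. *)
rewrite foldl_dual_pivot_pivotC // -mulrDr dist0_three_term;
  last exact: vf_closed_dual_pivots.
by rewrite size_rcons foldl_rcons exprS mulrN mulN1r mulNr.
Qed.

End SetSystemTheory.

Theorem theorem27 (T : finType) (M : {set {set T}})
    (hM : vf_closed_delta_matroid M) :
  ((q1 M).[-2%:R] = (-1) ^+ #|T| * (-2%:R) ^+ dist0 (dual_pivots M [set: T]) :> int)%R.
Proof.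
rewrite /q1 horner_sum /dual_pivots -cardsT cardE -sum_dist0_pivot ?enum_uniq //.
apply: eq_big => [X|X _]; last by rewrite hornerXn.
by apply/esym/subsetP=> x _; rewrite mem_enum inE.
Qed.
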